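(* For $1\le i\le n$ let $m'_i$ and $m''_i$ be the midpoints of $[x_{i-1},m_i]$ and $[m_i,x_i]$ respectively. (i) Given a function $f$ defined on $I=[a,b]$, there exists a unique generalized quadratic spline $Lf\in GS_2(I,X,\beta)$ satisfying the interpolation properties $$Lf(a)=f(a),\quad Lf(b)=f(b),\quad\text{and for }1\le i\le n:\quad Lf(m'_i)=f(m'_i),\quad Lf(m''_i)=f(m''_i).$$ (ii) The coefficients of $Lf=\sum_{k=0}^{2n+1}\gamma_kB_k$ satisfy $\gamma_0=f(a)$, $\gamma_{2n+1}=f(b)$ and are solutions of the tridiagonal system of $2n$ linear equations ($1\le i\le n$): $$\omega_{i-1}\gamma_{2i-2}+\big(3-\omega_{i-1}-\tfrac12\beta_i\big)\gamma_{2i-1}+\big(1+\tfrac12\beta_i\big)\gamma_{2i}=4f(m'_i),$$ $$\big(1+\tfrac12\beta_i\big)\gamma_{2i-1}+\big(2+\omega_i-\tfrac12\beta_i\big)\gamma_{2i}+(1-\omega_i)\gamma_{2i+1}=4f(m''_i).$$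
   Context: Setting. Let $n\ge 1$, $I=[a,b]$, $X=\{a=x_0<x_1<\dots<x_n=b\}$ a partition of $I$, $I_i=[x_{i-1},x_i]$, $h_i=x_i-x_{i-1}$, $m_i=\frac12(x_{i-1}+x_i)$ for $1\le i\le n$. Let $\beta=(\beta_1,\dots,\beta_n)$ with $\beta_i\in[-1,0[$ and $\theta_i=\frac12\frac{\beta_i}{\beta_i-1}\in\,]0,\frac14]$ (equivalently $\beta_i=\frac{-2\theta_i}{1-2\theta_i}$). The space $V(\beta_i)$ (generated by the Merrien subdivision algorithm) is the set of $C^1$ functions $f$ on $I_i$ such that for every dyadic subinterval $[u,v]$ of $I_i$ (i.e. every interval obtained from $I_i$ by repeated bisection, including $I_i$ itself), with $m=\frac12(u+v)$ and $h=v-u$, $$f(m)=\tfrac12\big(f(u)+f(v)-\theta_i h\,(f'(v)-f'(u))\big),\qquad f'(m)=\frac{1}{1-2\theta_i}\Big(\frac{f(v)-f(u)}{h}-2\theta_i\,\frac{f'(u)+f'(v)}{2}\Big).$$ It is known that for any prescribed values of $f,f'$ at the two endpoints of $I_i$ there is exactly one such $f$; so $\dim V(\beta_i)=4$. $GS_2(\beta)=GS_2(I,X,\beta)$ is the space of all $g\in C^1(I)$ with $g|_{I_i}\in V(\beta_i)$ for all $1\le i\le n$ (generalized quadratic splines); it has dimension $2n+2$. The list of B-coefficients of $f\in V(\beta_i)$ on $I_i$ is $[\,f(x_{i-1}),\ f(x_{i-1})+\theta_ih_if'(x_{i-1}),\ f(x_i)-\theta_ih_if'(x_i),\ f(x_i)\,]$;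 it determines $f$ uniquely. For $1\le i\le n-1$ let $\omega_i=\frac{\theta_{i+1}h_{i+1}}{\theta_ih_i+\theta_{i+1}h_{i+1}}$, and let $\omega_0=1$, $\omega_n=0$. The generalized quadratic B-splines are the functions on $I$ defined by their B-coefficients as follows (all B-coefficients on subintervals not mentioned are zero). For $1\le i\le n-1$: $B_{2i}$ has lists $[0,0,1,\omega_i]$ on $I_i$ and $[\omega_i,0,0,0]$ on $I_{i+1}$; $B_{2i+1}$ has lists $[0,0,0,1-\omega_i]$ on $I_i$ and $[1-\omega_i,1,0,0]$ on $I_{i+1}$. At the ends: $B_0$ has list $[1,0,0,0]$ on $I_1$; $B_1$ has list $[0,1,0,0]$ on $I_1$; $B_{2n}$ has list $[0,0,1,0]$ on $I_n$; $B_{2n+1}$ has list $[0,0,0,1]$ on $I_n$. The family $\{B_k\}_{0\le k\le 2n+1}$ is a basis of $GS_2(\beta)$. *)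

(* Defs.v *)
From HB Require Import structures.
From mathcomp Require Import all_boot all_order all_algebra.
From mathcomp Require Import all_classical all_reals all_analysis.
Set Implicit Arguments.
Unset Strict Implicit.
Unset Printing Implicit Defensive.
Import Order.TTheory GRing.Theory Num.Theory.
Import numFieldNormedType.Exports.
Local Open Scope classical_set_scope.
Local Open Scope ring_scope.

(* A function on a closed interval J is represented by a total function
   R -> R whose values outside J are irrelevant: every predicate below depends
   only on the restriction to J, and equality of functions is equality on J. *)

Section Defs.
Context {R : realType}.
Implicit Types (f g : R -> R) (u v : R).

Definition diffq f (t s : R) : R := (f s - f t) / (s - t).

(* For t an endpoint of a closed interval A this is the one-sided derivative. *)
Definition derive_within (A : set R) f (t : R) : R :=
  lim (diffq f t @ within A t^').

Definition C1_on (A : set R) f : Prop :=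
  (forall t, A t -> cvg (diffq f t @ within A t^')) /\
  {within A, continuous (derive_within A f)}.

Definition mid u v : R := (u + v) / 2.

Inductive dyadic_subitv (p q : R) : R -> R -> Prop :=
| dyadic_self : dyadic_subitv p q p q
| dyadic_left u v :
    dyadic_subitv p q u v -> dyadic_subitv p q u (mid u v)
| dyadic_right u v :
    dyadic_subitv p q u v -> dyadic_subitv p q (mid u v) v.

Definition theta (b : R) : R := 2^-1 * (b / (b - 1)).

(* V b p q f : the restriction of f to [p, q] belongs to the space V(b). *)
Definition V (b p q : R) f : Prop :=
  let f' := derive_within `[p, q] f in
  let th := theta b in
  C1_on `[p, q] f /\
  forall u v, dyadic_subitv p q u v ->
    let h := v - u in
    f (mid u v) = 2^-1 * (f u + f v - th * h * (f' v - f' u)) /\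
    f' (mid u v) =
      (1 - 2 * th)^-1 * ((f v - f u) / h - 2 * th * ((f' u + f' v) / 2)).

(* The knots are x 0 < ... < x n; the i-th subinterval (1 <= i <= n) is
   [x i.-1, x i], and it carries the parameter beta i. The values x i for
   n < i, and beta i for i = 0 or n < i, are not used. *)
Section Spline.
Variables (n : nat) (x beta : nat -> R).

Definition GS2 g : Prop :=
  C1_on `[x 0%N, x n] g /\
  forall i, (1 <= i <= n)%N -> V (beta i) (x i.-1) (x i) g.

Definition step (i : nat) : R := x i - x i.-1.

Definition bcoefs f (i : nat) : seq R :=
  let f' := derive_within `[x i.-1, x i] f in
  [:: f (x i.-1);
      f (x i.-1) + theta (beta i) * step i * f' (x i.-1);
      f (x i) - theta (beta i) * step i * f' (x i);
      f (x i)].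

(* A function on [x 0, x n] which on each subinterval [x i.-1, x i] belongs to
   V (beta i) and has the list of B-coefficients c i; such a function is
   determined on [x 0, x n] by c. *)
Definition fun_of_bcoefs (c : nat -> seq R) : R -> R :=
  xget (fun=> 0) [set g : R -> R | forall i, (1 <= i <= n)%N ->
    V (beta i) (x i.-1) (x i) g /\ bcoefs g i = c i].

Definition omega (i : nat) : R :=
  if i == 0%N then 1 else
  if i == n then 0 else
  theta (beta i.+1) * step i.+1 /
    (theta (beta i) * step i + theta (beta i.+1) * step i.+1).

(* B-coefficients, on the i-th subinterval, of the k-th B-spline, where
   k = 2j or k = 2j+1 with j = k./2, and 0 <= j <= n. *)
Definition bspline_bcoefs (k i : nat) : seq R :=
  let j := k./2 in
  if j == 0%N then
    if i == 1%N then if odd k then [:: 0; 1; 0; 0] else [:: 1; 0; 0; 0]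
    else [:: 0; 0; 0; 0]
  else if j == n then
    if i == n then if odd k then [:: 0; 0; 0; 1] else [:: 0; 0; 1; 0]
    else [:: 0; 0; 0; 0]
  else if i == j then
    if odd k then [:: 0; 0; 0; 1 - omega j] else [:: 0; 0; 1; omega j]
  else if i == j.+1 then
    if odd k then [:: 1 - omega j; 1; 0; 0] else [:: omega j; 0; 0; 0]
  else [:: 0; 0; 0; 0].

Definition bspline (k : nat) : R -> R := fun_of_bcoefs (bspline_bcoefs k).

Definition mpt (i : nat) : R := mid (x i.-1) (x i).
Definition mpt' (i : nat) : R := mid (x i.-1) (mpt i).
Definition mpt'' (i : nat) : R := mid (mpt i) (x i).

Definition interpolates f g : Prop :=
  [/\ g (x 0%N) = f (x 0%N), g (x n) = f (x n) &
      forall i, (1 <= i <= n)%N ->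
        g (mpt' i) = f (mpt' i) /\ g (mpt'' i) = f (mpt'' i)].

Definition bspline_expansion g (gamma : nat -> R) : Prop :=
  forall t, t \in `[x 0%N, x n] ->
    g t = \sum_(0 <= k < (2 * n).+2) gamma k * bspline k t.

End Spline.
End Defs.

(* Main.v *)
Require Import Defs.
From HB Require Import structures.
From mathcomp Require Import all_boot all_order all_algebra.
From mathcomp Require Import all_classical all_reals all_analysis.
From mathcomp Require Import ring lra zify.
Import Order.TTheory GRing.Theory Num.Theory.
Import numFieldNormedType.Exports.
Local Open Scope classical_set_scope.
Local Open Scope ring_scope.

(** Write lam = - beta / 2, which lies in ]0, 1/2]. The mean of f' over a dyadic
interval [u, v] is theta a + (1 - 2 theta) c + theta b, where a, c, b are the
values of f' at u, at the midpoint and at v; substituted into the rules that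
define V (beta), this says that the values of f' at the two quarter points are
lam a + (1 - lam) c and lam b + (1 - lam) c. So on each half of its interval f'
is an affine copy of one standard increasing function phi, the [slope]: it is 0
before 0, 1 after 1, and solves
   phi t = (1 - lam) phi (2 t) - lam phi (2 - 2 t) + lam.
At each t one of the two terms on the right is constant, and lam <= 1 - lam, so
iteration of the right-hand side contracts uniformly by 1 - lam and phi is
continuous. A primitive Phi of phi satisfies the integrated equation, and
combinations of copies of Phi ([hermite]) stay of the same shape on every
dyadic subinterval. This gives an element of V (beta) with any prescribed
endpoint values and slopes ([V_hermite_exists]); since the rules propagate the
data to all dyadic points, which are dense, it is the only one ([V_unique]).
Two applications of the rules give the values at the quarter points in terms
of the B-coefficients ([V_quarter_values]).

On the i-th piece only the four B-splines attached to the knots x i.-1 and x i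
are non zero, so a combination with coefficients gamma has there the
B-coefficients y_{i-1}, gamma_{2i-1}, gamma_{2i}, y_i, with
y_i = omega_i gamma_{2i} + (1 - omega_i) gamma_{2i+1} ([spline_bcoefs]). The
weights omega_i are exactly those for which the slopes of adjacent pieces
agree, so every combination is in GS2 ([spline_GS2]), and reading gamma off the
values and slopes at the knots shows that every element of GS2 is such a
combination ([GS2_expansion]). Interpolation thus becomes the tridiagonal system
of part (ii) ([spline_interpolates]). Its rows are strictly diagonally dominant,
the diagonal coefficient exceeding the sum of the others by
2 - 2 omega_{i-1} - beta_i or 2 omega_i - beta_i, so the system has exactly one
solution, and part (i) follows. *)

Set Implicit Arguments.
Unset Strict Implicit.
Unset Printing Implicit Defensive.

(** * One-sided derivatives on closed intervals *)

Section OneSidedDerivatives.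
Context {R : realType}.
Implicit Types (A B : set R) (f g : R -> R) (p q r t l : R).

Definition has_deriv A f t l : Prop := diffq f t @ within A t^' --> l.

Lemma within_dnbhs_proper p q t :
  p < q -> t \in `[p, q] -> ProperFilter (within `[p, q]%classic t^').
Proof.
move=> pq; rewrite in_itv/= => /andP[pt tq].
apply: Build_ProperFilter_ex => P; rewrite /within/= /nbhs/= => -[e /= e0 eP].
have [tltq|qlet] := ltP t q.
- exists (t + Num.min (e / 2) (q - t)).
  have m0 : 0 < Num.min (e / 2) (q - t) by rewrite lt_min; lra.
  have m1 : Num.min (e / 2) (q - t) <= e / 2 by rewrite ge_min lexx.
  have m2 : Num.min (e / 2) (q - t) <= q - t by rewrite ge_min lexx orbT.
  apply: eP => /=; rewrite ?in_itv/=.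
  + by rewrite opprD addNKr normrN gtr0_norm//; lra.
  + by apply/eqP; lra.
  + by apply/andP; split; lra.
- exists (t - Num.min (e / 2) (q - p)).
  have m0 : 0 < Num.min (e / 2) (q - p) by rewrite lt_min; lra.
  have m1 : Num.min (e / 2) (q - p) <= e / 2 by rewrite ge_min lexx.
  have m2 : Num.min (e / 2) (q - p) <= q - p by rewrite ge_min lexx orbT.
  apply: eP => /=; rewrite ?in_itv/=.
  + by rewrite opprB addrCA subrr addr0 gtr0_norm//; lra.
  + by apply/eqP; lra.
  + by apply/andP; split; lra.
Qed.

Lemma within_dnbhs_cvg A t : within A t^' --> t.
Proof.
move=> P nP; rewrite /= nbhs_simpl /within /=.
have : \forall s \near t^', P s by exact: cvg_within.
by apply: filterS.
Qed.

Lemma has_deriv_derive_within p q f t l : p < q -> t \in `[p, q] ->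
  has_deriv `[p, q] f t l -> derive_within `[p, q] f t = l.
Proof.
move=> pq tpq h; have := within_dnbhs_proper pq tpq => ?.
by apply: cvg_lim => //; exact: Rhausdorff.
Qed.

(** Differentiability at t depends only on the germ of the domain at t. It lets
a derivative pass both to a subinterval and, at interior points, to a larger
interval. *)
Lemma has_deriv_near A B f t l :
  (\forall s \near t, B s -> A s) -> has_deriv A f t l -> has_deriv B f t l.
Proof.
move=> BA h P /h; rewrite /= !nbhs_simpl /within /=.
have BA' : \forall s \near t^', B s -> A s by exact: cvg_within.
by apply: filterS2 BA' => s BAs Ps /BAs.
Qed.

Lemma has_derivS A B f t l :
  B `<=` A -> has_deriv A f t l -> has_deriv B f t l.
Proof.
move=> BA; have BA' : \forall s \near t, B s -> A s by apply: filterE => s; exact: BA.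
exact: has_deriv_near BA'.
Qed.

Lemma has_derivU A B f t l :
  has_deriv A f t l -> has_deriv B f t l -> has_deriv (A `|` B) f t l.
Proof.
move=> hA hB P nP; move: (hA _ nP) (hB _ nP).
rewrite /= !nbhs_simpl /within/=.
by apply: filterS2 => s As Bs [/As|/Bs].
Qed.

Lemma eq_has_deriv A f g t l : {in A, f =1 g} -> A t ->
  has_deriv A f t l -> has_deriv A g t l.
Proof.
move=> fg At; apply: cvg_trans; apply: near_eq_cvg.
rewrite near_withinE; apply: nearW => s As.
by rewrite /diffq !fg// inE.
Qed.

Lemma has_deriv_cvg A f t l : has_deriv A f t l ->
  f @ within A (nbhs t) --> f t.
Proof.
move=> h.
have h1 : f @ within A t^' --> f t.
  have : (fun s => f t + diffq f t s * (s - t)) @ within A t^' --> f t + l * (t - t).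
    apply: cvgD; first exact: cvg_cst.
    apply: cvgM; first exact: h.
    apply: cvgB; last exact: cvg_cst.
    exact: within_dnbhs_cvg.
  rewrite subrr mulr0 addr0; apply: cvg_trans; apply: near_eq_cvg.
  rewrite near_withinE.
  have : \forall s \near t^', s != t by exact: nbhs_dnbhs_neq.
  apply: filterS => s st _; rewrite /diffq divfK ?subr_eq0//; ring.
move=> P nP.
have : \forall s \near within A t^', P (f s) by exact: h1.
suff : (\forall s \near within A t^', P (f s)) ->
  \forall s \near within A (nbhs t), P (f s) by [].
rewrite !near_withinE; apply: filterS => s hs As.
have [->|st] := eqVneq s t; first exact: (nbhs_singleton nP).
exact: hs.
Qed.

Lemma cvg_lincomb (T : Type) (F : set_system T) (N : nat) (c : nat -> R)
    (u : nat -> T -> R) (l : nat -> R) : Filter F ->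
  (forall k, (k < N)%N -> u k @ F --> l k) ->
  (fun s => \sum_(0 <= k < N) c k * u k s) @ F --> \sum_(0 <= k < N) c k * l k.
Proof.
move=> FF; elim: N => [|N IH] h.
  rewrite big_geq//; under eq_fun do rewrite big_geq//.
  exact: cvg_cst.
rewrite big_nat_recr//=; under eq_fun do rewrite big_nat_recr//=.
apply: cvgD; first by apply: IH => k kN; exact: h (ltnW kN).
by apply: cvgM; [exact: cvg_cst|exact: h].
Qed.

Lemma has_deriv_lincomb (N : nat) A (c : nat -> R) (F : nat -> R -> R)
    (d : nat -> R) t :
  (forall k, (k < N)%N -> has_deriv A (F k) t (d k)) ->
  has_deriv A (fun s => \sum_(0 <= k < N) c k * F k s) t
    (\sum_(0 <= k < N) c k * d k).
Proof.
move=> h; rewrite /has_deriv.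
have -> : diffq (fun s => \sum_(0 <= k < N) c k * F k s) t =
    fun s => \sum_(0 <= k < N) c k * diffq (F k) t s.
  apply/funext => s; rewrite /diffq -sumrB mulr_suml.
  by apply: eq_bigr => k _; rewrite mulrA mulrBr.
exact: cvg_lincomb.
Qed.

Lemma has_deriv_is_derive A f t l : is_derive t 1 f l -> has_deriv A f t l.
Proof.
move=> /is_derive1_caratheodory[g [fg cg <-]].
have h : g @ within A t^' --> g t.
  by apply: cvg_trans cg; apply: cvg_app; exact: within_dnbhs_cvg.
apply: cvg_trans h; apply: near_eq_cvg; rewrite near_withinE.
have : \forall s \near t^', s != t by exact: nbhs_dnbhs_neq.
by apply: filterS => s st _; rewrite /diffq fg mulfK// subr_eq0.
Qed.

Lemma C1_on_has_deriv A f t : C1_on A f -> A t ->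
  has_deriv A f t (derive_within A f t).
Proof. by case=> + _ At => /(_ _ At). Qed.

Lemma C1_on_intro p q f f' : p < q ->
  (forall t, t \in `[p, q] -> has_deriv `[p, q] f t (f' t)) ->
  {within `[p, q], continuous f'} -> C1_on `[p, q] f.
Proof.
move=> pq hf cf'; split; first by move=> t /hf h; apply/cvg_ex; exists (f' t).
apply: subspace_eq_continuous cf' => t; rewrite inE => /= tpq.
by apply/esym/has_deriv_derive_within => //; exact: hf.
Qed.

Lemma derive_within_lincomb (N : nat) p q (c : nat -> R) (F : nat -> R -> R) t :
  p < q -> (forall k, (k < N)%N -> C1_on `[p, q] (F k)) -> t \in `[p, q] ->
  derive_within `[p, q] (fun s => \sum_(0 <= k < N) c k * F k s) t =
  \sum_(0 <= k < N) c k * derive_within `[p, q] (F k) t.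
Proof.
move=> pq CF tpq; apply: has_deriv_derive_within => //.
by apply: has_deriv_lincomb => k kN; exact: C1_on_has_deriv (CF k kN) _.
Qed.

Lemma C1_on_lincomb (N : nat) p q (c : nat -> R) (F : nat -> R -> R) :
  p < q -> (forall k, (k < N)%N -> C1_on `[p, q] (F k)) ->
  C1_on `[p, q] (fun s => \sum_(0 <= k < N) c k * F k s).
Proof.
move=> pq CF; apply: (@C1_on_intro _ _ _
    (fun t => \sum_(0 <= k < N) c k * derive_within `[p, q] (F k) t)) => //.
  move=> t tpq; apply: has_deriv_lincomb => k kN.
  exact: C1_on_has_deriv (CF k kN) _.
by move=> t; apply: cvg_lincomb => k kN; exact: (CF k kN).2.
Qed.

Lemma eq_derive_within p q f g t : p < q -> C1_on `[p, q] f ->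
  {in `[p, q], f =1 g} -> t \in `[p, q] ->
  derive_within `[p, q] g t = derive_within `[p, q] f t.
Proof.
move=> pq Cf fg tpq; apply: has_deriv_derive_within => //.
apply: (eq_has_deriv _ _ (C1_on_has_deriv Cf tpq)) => //.
by move=> s; rewrite inE => /fg.
Qed.

Lemma eq_C1_on p q f g : p < q ->
  {in `[p, q], f =1 g} -> C1_on `[p, q] f -> C1_on `[p, q] g.
Proof.
move=> pq fg Cf.
apply: (@C1_on_intro _ _ _ (derive_within `[p, q] f)) Cf.2 => // t tpq.
apply: (eq_has_deriv _ _ (C1_on_has_deriv Cf tpq)) => //.
by move=> s; rewrite inE => /fg.
Qed.

Lemma derive_withinS p q u v f t : u < v -> `[u, v] `<=` `[p, q] ->
  C1_on `[p, q] f -> t \in `[u, v] ->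
  derive_within `[u, v] f t = derive_within `[p, q] f t.
Proof.
move=> uv sub Cf tuv; apply: has_deriv_derive_within => //.
by apply: (has_derivS sub); apply: C1_on_has_deriv (sub _ _).
Qed.

(** Equality of the one-sided derivatives at the common endpoint makes the
difference quotient converge along the union, and continuity of the pasted
derivative is the pasting lemma for two closed sets. The second conclusion is
what allows further intervals to be attached on the right. *)
Lemma C1_on_paste p q r f : p < q -> q < r ->
  C1_on `[p, q] f -> C1_on `[q, r] f ->
  derive_within `[p, q] f q = derive_within `[q, r] f q ->
  C1_on `[p, r] f /\ derive_within `[p, r] f r = derive_within `[q, r] f r.
Proof.
move=> pq qr Cpq Cqr eqq; have pr := lt_trans pq qr.
have prU : `[p, r]%classic = `[p, q] `|` `[q, r].
  apply/seteqP; split => t /=; rewrite !in_itv/=.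
    by move=> /andP[pt tr]; have [tq|qt] := leP t q; [left|right];
      rewrite ?pt ?tr ?(ltW qt).
  by case=> /andP[h1 h2]; apply/andP; split; lra.
pose d t := if t <= q then derive_within `[p, q] f t
            else derive_within `[q, r] f t.
have hd t : t \in `[p, r] -> has_deriv `[p, r] f t (d t).
  rewrite in_itv/= /d => /andP[pt tr]; have [tq|qt|tq] := ltgtP t q.
  - apply: (@has_deriv_near `[p, q]).
      have : \forall s \near t, s < q by exact: lt_nbhsl.
      by apply: filterS => s sq /=; rewrite !in_itv/= => /andP[-> _]; exact: ltW.
    by apply: C1_on_has_deriv => //=; rewrite in_itv/= pt ltW.
  - apply: (@has_deriv_near `[q, r]).
      have : \forall s \near t, q < s by exact: lt_nbhsr.
      by apply: filterS => s sq /=; rewrite !in_itv/= => /andP[_ ->]; rewrite ltW.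
    by apply: C1_on_has_deriv => //=; rewrite in_itv/= tr ltW.
  - rewrite prU tq; apply: has_derivU; last rewrite eqq;
      by apply: C1_on_has_deriv => //=; rewrite in_itv/= lexx ltW.
have cd : {within `[p, r], continuous d}.
  rewrite prU; apply: withinU_continuous.
  - exact: itv_closed.
  - exact: itv_closed.
  - apply: subspace_eq_continuous Cpq.2 => t.
    by rewrite inE/= in_itv/= /from_subspace /d => /andP[_ ->].
  - apply: subspace_eq_continuous Cqr.2 => t.
    rewrite inE/= in_itv/= => /andP[qt _]; rewrite /from_subspace /d.
    case: ifPn => // tq.
    by have -> : t = q by apply/eqP; rewrite eq_le tq qt.
split; first exact: C1_on_intro hd cd.
have rpr : r \in `[p, r] by rewrite in_itv/= lexx ltW.
by rewrite (has_deriv_derive_within pr rpr (hd _ rpr)) /d leNgt qr.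
Qed.

End OneSidedDerivatives.

(** * The standard slope function *)

Section LimitDerivative.
Context {R : realType} (lam : R) (lam_gt0 : 0 < lam) (lam_le : lam <= 2^-1).
Implicit Types (t s : R).

(** Iterates of the refinement operator, started from t clamped to [0, 1], which
has the right values outside ]0, 1[. No case distinction at 1/2 is needed in the
operator: outside its half each term takes the constant value 0 or 1. *)
Fixpoint slope_iter (k : nat) : R -> R :=
  if k is k'.+1 then fun t =>
    (1 - lam) * slope_iter k' (2 * t) - lam * slope_iter k' (2 - 2 * t) + lam
  else fun t => Num.max 0 (Num.min t 1).

Lemma slope_iter_le0 k t : t <= 0 -> slope_iter k t = 0.
Proof.
suff [] : (forall s, s <= 0 -> slope_iter k s = 0) /\
          (forall s, 1 <= s -> slope_iter k s = 1) by move=> + _ => /[apply].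
elim: k => [|k [IH0 IH1]]; split=> s hs /=.
- by rewrite max_l// ge_min hs.
- by rewrite min_r// max_r.
- by rewrite IH0 ?IH1; lra.
- by rewrite IH1 ?IH0; lra.
Qed.

Lemma slope_iter_ge1 k t : 1 <= t -> slope_iter k t = 1.
Proof.
elim: k t => [|k IH] t t1 /=; first by rewrite min_r// max_r.
by rewrite IH ?slope_iter_le0; lra.
Qed.

(** The successive differences vanish outside ]0, 1[. Since 2 t and 2 - 2 t add
up to 2, at most one of them lies in that interval, so a refinement step
multiplies the sup norm of the difference by at most max (1 - lam) lam. *)
Lemma slope_iter_dist k t : `|slope_iter k.+1 t - slope_iter k t| <= (1 - lam) ^+ k.
Proof.
have l0 := lam_gt0; have l1 := lam_le.
elim: k t => [|k IH] t.
  have [t0|t0] := leP t 0; first by rewrite !slope_iter_le0// subrr normr0.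
  have [t1|t1] := leP 1 t; first by rewrite !slope_iter_ge1// subrr normr0.
  rewrite expr0 -[slope_iter 0 t]/(Num.max 0 (Num.min t 1)).
  rewrite (min_l (ltW t1)) (max_r (ltW t0)) /=.
  have h0 : 0 <= t * (1 - 2 * lam) by apply: mulr_ge0; lra.
  have h1 : 0 <= (1 - t) * (1 - 2 * lam) by apply: mulr_ge0; lra.
  have h2 : 0 <= t * lam by apply: mulr_ge0; lra.
  have h3 : 0 <= (1 - t) * lam by apply: mulr_ge0; lra.
  have [t2|t2] := leP t 2^-1.
    rewrite (min_r (_ : 1 <= 2 - 2 * t)); last lra.
    rewrite (min_l (_ : 2 * t <= 1)); last lra.
    rewrite !max_r; try lra.
    by rewrite ler_norml; apply/andP; split; lra.
  rewrite (min_r (_ : 1 <= 2 * t)); last lra.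
  rewrite (min_l (_ : 2 - 2 * t <= 1)); last lra.
  rewrite !max_r; try lra.
  by rewrite ler_norml; apply/andP; split; lra.
have -> : slope_iter k.+2 t - slope_iter k.+1 t =
    (1 - lam) * (slope_iter k.+1 (2 * t) - slope_iter k (2 * t))
    - lam * (slope_iter k.+1 (2 - 2 * t) - slope_iter k (2 - 2 * t)).
  rewrite -[slope_iter k.+2 t]/((1 - lam) * slope_iter k.+1 (2 * t)
    - lam * slope_iter k.+1 (2 - 2 * t) + lam).
  rewrite -[slope_iter k.+1 t]/((1 - lam) * slope_iter k (2 * t)
    - lam * slope_iter k (2 - 2 * t) + lam).
  by ring.
rewrite exprS.
have p0 : 0 <= (1 - lam) ^+ k by apply: exprn_ge0; lra.
have [t2|t2] := leP t 2^-1.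
  rewrite !(@slope_iter_ge1 _ (2 - 2 * t)) ?subrr ?mulr0 ?subr0; try lra.
  by rewrite normrM ger0_norm; [apply: ler_wpM2l; [lra|exact: IH]|lra].
rewrite !(@slope_iter_ge1 _ (2 * t)) ?subrr ?mulr0 ?sub0r; try lra.
rewrite normrN normrM ger0_norm; last lra.
by apply: ler_pM => //; lra.
Qed.

(** Geometric sum of the previous bounds. *)
Lemma slope_iter_dist_add k j t :
  `|slope_iter (k + j) t - slope_iter k t| <= (1 - lam) ^+ k / lam.
Proof.
have l0 := lam_gt0; have l1 := lam_le.
(* The sharper bound, with the partial geometric sum, is what the induction keeps. *)
suff : `|slope_iter (k + j) t - slope_iter k t| <=
    (1 - lam) ^+ k * ((1 - (1 - lam) ^+ j) / lam).
  move=> /le_trans; apply.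
  apply: ler_wpM2l; first by apply: exprn_ge0; lra.
  rewrite -[leRHS]mul1r ler_pM2r ?invr_gt0// lerBlDr lerDl.
  by apply: exprn_ge0; lra.
elim: j => [|j IH]; first by rewrite addn0 subrr normr0 expr0 subrr mul0r mulr0.
rewrite addnS -(subrKA (slope_iter (k + j) t)).
apply: le_trans (ler_normD _ _) _.
apply: le_trans (lerD (slope_iter_dist _ _) IH) _.
rewrite exprD exprS -mulrDr le_eqVlt; apply/orP; left; apply/eqP.
by field; rewrite gt_eqF.
Qed.

Lemma slope_iter_continuous k : continuous (slope_iter k).
Proof.
elim: k => [|k IH] t.
  rewrite -[slope_iter 0]/((fun=> 0) \max ((@id R) \min (fun=> 1))).
  apply: continuous_max; first exact: cvg_cst.
  by apply: continuous_min; [exact: cvg_id|exact: cvg_cst].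
have c2 : {for t, continuous (fun s : R => 2 * s)}.
  by apply: cvgM; [exact: cvg_cst|exact: cvg_id].
apply: cvgD; last exact: cvg_cst.
apply: cvgB; (apply: cvgM; first exact: cvg_cst).
  by apply: (@continuous_comp _ _ _ (fun s => 2 * s) (slope_iter k)); last exact: IH.
apply: (@continuous_comp _ _ _ (fun s => 2 - 2 * s) (slope_iter k)).
  by apply: cvgB => //; exact: cvg_cst.
exact: IH.
Qed.

Lemma slope_iter_geometric (e : R) : 0 < e ->
  \forall k \near \oo, (1 - lam) ^+ k / lam < e.
Proof.
have l0 := lam_gt0; have l1 := lam_le.
move=> e0.
have /cvgr0_norm_lt : (fun k => (1 - lam) ^+ k / lam) @ \oo --> (0 : R).
  rewrite -[0](mul0r lam^-1); apply: cvgM; last exact: cvg_cst.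
  by apply: cvg_expr; rewrite ger0_norm; lra.
move=> /(_ _ e0); apply: filterS => k; apply: le_lt_trans; exact: ler_norm.
Qed.

Lemma slope_iter_cvg t : cvg (slope_iter ^~ t @ \oo).
Proof.
apply/cauchy_cvgP/cauchy_exP => e e0.
have [k _ /(_ k (leqnn k)) /= ke] := slope_iter_geometric e0.
exists (slope_iter k t).
exists k => // m /= km; rewrite -ball_normE/= distrC -(subnKC km).
exact: le_lt_trans (slope_iter_dist_add _ _ _) ke.
Qed.

Definition slope t : R := lim (slope_iter ^~ t @ \oo).

Lemma slope_le0 t : t <= 0 -> slope t = 0.
Proof.
move=> t0; apply: cvg_lim => //.
by under eq_fun do rewrite slope_iter_le0//; exact: cvg_cst.
Qed.

Lemma slope_ge1 t : 1 <= t -> slope t = 1.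
Proof.
move=> t0; apply: cvg_lim => //.
by under eq_fun do rewrite slope_iter_ge1//; exact: cvg_cst.
Qed.

Lemma slope_refine t : slope t =
  (1 - lam) * slope (2 * t) - lam * slope (2 - 2 * t) + lam.
Proof.
apply: cvg_lim => //; rewrite -cvg_shiftS /=.
apply: cvgD; last exact: cvg_cst.
by apply: cvgB; (apply: cvgM; first exact: cvg_cst); exact: slope_iter_cvg.
Qed.

Lemma slope_dist k t : `|slope t - slope_iter k t| <= (1 - lam) ^+ k / lam.
Proof.
have : (fun n => `|slope_iter n t - slope_iter k t|) @ \oo -->
    `|slope t - slope_iter k t|.
  by apply: cvg_norm; apply: cvgB; [exact: slope_iter_cvg|exact: cvg_cst].
move=> /cvgr_to_le; apply; exists k => // m /= km.
by rewrite -(subnKC km); exact: slope_iter_dist_add.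
Qed.

Lemma slope_continuous : continuous slope.
Proof.
move=> t; apply/cvgrPdist_lt => e e0.
have e3 : 0 < e / 3 by rewrite divr_gt0.
have [k _ /(_ k (leqnn k)) /= ke] := slope_iter_geometric e3.
have /cvgrPdist_lt/(_ _ e3) := @slope_iter_continuous k t.
apply: filterS => s hs.
have := le_lt_trans (slope_dist k t) ke.
have := le_lt_trans (slope_dist k s) ke.
by move: hs; rewrite !ltr_norml; lra.
Qed.

End LimitDerivative.

(** The lower bound c is where the integral that defines F starts. *)
Lemma continuous_primitive (R : realType) (c : R) (f : R -> R) :
  continuous f -> exists F : R -> R, forall t, c < t -> is_derive t 1 F (f t).
Proof.
move=> cf.
pose F (x : R) := (\int[lebesgue_measure]_(t in [set` `[c, x]]) (f t))%R.
exists F => t ct; have tt1 : t < t + 1 by rewrite ltrDl.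
have fi : lebesgue_measure.-integrable `[c, t + 1] (EFin \o f).
  apply: continuous_compact_integrable; first exact: segment_compact.
  exact: continuous_subspaceT.
have [dF F't] := continuous_FTC1_closed tt1 fi ct (cf t).
by apply: DeriveDef; [exact: dF|rewrite -derive1E; exact: F't].
Qed.

Lemma is_derive0_const (R : realType) (F : R -> R) (a b : R) :
  (forall t, t \in `[a, b] -> is_derive t 1 F 0) ->
  forall t, t \in `[a, b] -> F t = F a.
Proof.
move=> dF t; rewrite in_itv/= => /andP[at_ tb].
have dF' s : s \in `]a, t[ -> is_derive s 1 F 0.
  by rewrite in_itv/= => /andP[as_ st]; apply: dF; rewrite in_itv/=; lra.
have cF : {within `[a, t], continuous F}.
  apply: continuous_in_subspaceT => s; rewrite inE/= in_itv/= => /andP[as_ st].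
  have := dF s; rewrite in_itv/= as_ (le_trans st tb) => /(_ isT) [ds _].
  by apply: differentiable_continuous; exact/derivable1_diffP.
have [c _ /eqP] := MVT_segment at_ dF' cF.
by rewrite mul0r subr_eq0 => /eqP.
Qed.

(** * A primitive of the slope function *)

Lemma is_derive_affine (R : realType) (F : R -> R) (m c t l : R) :
  is_derive (m * t + c) 1 F l -> is_derive t 1 (fun s => F (m * s + c)) (m * l).
Proof.
move=> dF.
have dg : is_derive t 1 (fun s : R => m * s + c) m.
  have -> : (fun s : R => m * s + c) = (m \*: (@id R)) + cst c by [].
  apply: is_derive_eq.
  by rewrite addr0 [_%:A]mulr1.
rewrite mulrC.
exact: (@is_derive1_comp _ F (fun s : R => m * s + c)).
Qed.

Section SlopePrimitive.
Context {R : realType}.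
Implicit Types (t s u v h k a b c lam : R).

(** The differential equation is required beyond [0, 1] because the refinement
equation evaluates Phi on [0, 2]. *)
Definition slope_primitive lam (Phi : R -> R) : Prop :=
  [/\ forall t, -1 < t -> is_derive t 1 Phi (slope lam t),
      Phi 0 = 0,
      Phi 1 = (1 + 2 * lam)^-1,
      (forall t, 1 <= t <= 2 -> Phi t = Phi 1 + (t - 1)) &
      (forall t, 0 <= t <= 1 -> Phi t = (1 - lam) / 2 * Phi (2 * t)
         + lam / 2 * (Phi (2 - 2 * t) - Phi 2) + lam * t)].

(** The two sides of each functional equation for Phi have the same derivative,
by the equations for the slope, and agree at one point. Comparing the last
equation at 1 with the linear growth on [1, 2] determines Phi 1, the integral
of the slope over [0, 1]. *)
Lemma slope_primitive_exists lam : 0 < lam -> lam <= 2^-1 -> exists Phi, slope_primitive lam Phi.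
Proof.
move=> l0 l1.
have [F dF] := @continuous_primitive _ (-1) _ (slope_continuous l0 l1).
pose Phi t := F t - F 0.
have dPhi t : -1 < t -> is_derive t 1 Phi (slope lam t).
  move=> t1; rewrite -[slope lam t]subr0.
  have -> : Phi = F - cst (F 0) by [].
  have := dF t t1 => ?.
  exact: is_deriveB.
have Phi0 : Phi 0 = 0 by rewrite /Phi subrr.
have PhiE t : 1 <= t <= 2 -> Phi t = Phi 1 + (t - 1).
  move=> t12; pose D := Phi - (@id R).
  have dD s : s \in `[1, 2] -> is_derive s 1 D 0.
    rewrite in_itv/= => /andP[s1 s2].
    have := dPhi s; rewrite slope_ge1// => /(_ ltac:(lra)) ?.
    by apply: is_derive_eq; rewrite subrr.
  have := is_derive0_const dD; move/(_ t); rewrite in_itv/= => /(_ t12).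
  by rewrite /D -[(Phi - id) t]/(Phi t - t) -[(Phi - id) 1]/(Phi 1 - 1); lra.
have PhiR t : 0 <= t <= 1 -> Phi t = (1 - lam) / 2 * Phi (2 * t)
         + lam / 2 * (Phi (2 - 2 * t) - Phi 2) + lam * t.
  move=> t01.
  pose G1 (s : R) := Phi (2 * s + 0); pose G2 (s : R) := Phi ((-2) * s + 2).
  pose D := Phi - ((1 - lam) / 2) \*: G1 - (lam / 2) \*: G2 - lam \*: (@id R).
  have dD s : s \in `[0, 1] -> is_derive s 1 D 0.
    rewrite in_itv/= => /andP[s0 s1].
    have dP := dPhi s ltac:(lra).
    have dG1 : is_derive s 1 G1 (2 * slope lam (2 * s)).
      by rewrite -[2 * s]addr0; apply: is_derive_affine; apply: dPhi; lra.
    have dG2 : is_derive s 1 G2 ((-2) * slope lam (2 - 2 * s)).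
      rewrite (_ : 2 - 2 * s = (-2) * s + 2); last by ring.
      by apply: is_derive_affine; apply: dPhi; lra.
    apply: is_derive_eq.
    by rewrite (slope_refine l0 l1 s) /GRing.scale/=; field.
  have := is_derive0_const dD; move/(_ t); rewrite in_itv/= => /(_ t01).
  have DE s : D s = Phi s - (1 - lam) / 2 * Phi (2 * s)
    - lam / 2 * Phi (2 - 2 * s) - lam * s.
    rewrite (_ : 2 - 2 * s = (-2) * s + 2); last by ring.
    by rewrite -[2 * s]addr0.
  rewrite !DE !mulr0 !subr0 Phi0; lra.
exists Phi; split => //.
have Phi2 := PhiE 2 ltac:(lra).
have h := PhiR 1 ltac:(lra); rewrite !mulr1 subrr Phi0 Phi2 in h.
 apply: (@mulIf _ (1 + 2 * lam)); first by rewrite gt_eqF//; lra.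
by rewrite mulVf; [lra|rewrite gt_eqF//; lra].
Qed.

End SlopePrimitive.

(** * Self-similar Hermite interpolants *)

Section Hermite.
Context {R : realType}.
Implicit Types (p q t s u v k a b c lam : R).

(** The function with value k at u whose derivative is a, c, b at u, at the
midpoint and at v, and runs between these values along copies of the slope. On
the left half of [u, v] the factor of b - c vanishes, and on the right half
that of c - a grows linearly in t. *)
Definition hermite (Phi : R -> R) k a c b u v t : R :=
  let h := v - u in let s := (t - u) / h in
  k + a * (t - u) + (c - a) * (h / 2 * Phi (2 * s))
    + (b - c) * (t - u + h / 2 * (Phi (2 - 2 * s) - Phi 2)).

Definition hermite' lam a c b u v t : R :=
  let s := (t - u) / (v - u) in
  a + (c - a) * slope lam (2 * s) + (b - c) * (1 - slope lam (2 - 2 * s)).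

Lemma is_derive_hermite lam Phi k a c b u v t : slope_primitive lam Phi ->
  u < v -> u <= t <= v ->
  is_derive t 1 (hermite Phi k a c b u v) (hermite' lam a c b u v t).
Proof.
move=> [dPhi _ _ _ _] uv utv; set h := v - u.
have h0 : 0 < h by rewrite /h; lra.
have hn0 : h != 0 by rewrite gt_eqF.
set s := (t - u) / h.
have s01 : 0 <= s <= 1.
  by rewrite /s ler_pdivlMr// ler_pdivrMr// mul0r mul1r /h; lra.
pose G1 x := Phi (2 / h * x + - (2 / h * u)).
pose G2 x := Phi (- (2 / h) * x + (2 + 2 / h * u)).
have dG1 : is_derive t 1 G1 (2 / h * slope lam (2 * s)).
  rewrite (_ : 2 * s = 2 / h * t + - (2 / h * u)); last by rewrite /s; field.
  apply: is_derive_affine; apply: dPhi.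
  by rewrite (_ : _ + _ = 2 * s); [lra|rewrite /s; field].
have dG2 : is_derive t 1 G2 (- (2 / h) * slope lam (2 - 2 * s)).
  rewrite (_ : 2 - 2 * s = - (2 / h) * t + (2 + 2 / h * u)); last first.
    by rewrite /s; field.
  apply: is_derive_affine; apply: dPhi.
  by rewrite (_ : _ + _ = 2 - 2 * s); [lra|rewrite /s; field].
have -> : hermite Phi k a c b u v = cst (k - b * u + c * u - a * u
      - (b - c) * (h / 2) * Phi 2)
    + (a + b - c) \*: (@id R)
    + ((c - a) * (h / 2)) \*: G1 + ((b - c) * (h / 2)) \*: G2.
  apply/funext => x; rewrite /hermite -/h.
  rewrite -[RHS]/(k - b * u + c * u - a * u
      - (b - c) * (h / 2) * Phi 2 + (a + b - c) * x
    + ((c - a) * (h / 2)) * G1 x + ((b - c) * (h / 2)) * G2 x).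
  rewrite /G1 /G2 (_ : 2 / h * x + - (2 / h * u) = 2 * ((x - u) / h)); last by field.
  rewrite (_ : - (2 / h) * x + (2 + 2 / h * u) = 2 - 2 * ((x - u) / h)); last by field.
  by field.
apply: is_derive_eq.
rewrite /GRing.scale/= /hermite' -/h -/s; field.
exact: hn0.
Qed.

Lemma hermite'_continuous lam a c b u v : 0 < lam -> lam <= 2^-1 ->
  continuous (hermite' lam a c b u v).
Proof.
move=> l0 l1 t; have cs := slope_continuous l0 l1.
have c2 : {for t, continuous (fun x => 2 * ((x - u) / (v - u)))}.
  apply: cvgM; first exact: cvg_cst.
  apply: cvgM; last exact: cvg_cst.
  by apply: cvgB; [exact: cvg_id|exact: cvg_cst].
apply: cvgD; first apply: cvgD; first exact: cvg_cst.
  apply: cvgM; first exact: cvg_cst.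
  by apply: (@continuous_comp _ _ _ (fun x => 2 * ((x - u) / (v - u))) (slope lam)); last exact: cs.
apply: cvgM; first exact: cvg_cst.
apply: cvgB; first exact: cvg_cst.
apply: (@continuous_comp _ _ _ (fun x => 2 - 2 * ((x - u) / (v - u))) (slope lam)).
  by apply: cvgB; [exact: cvg_cst|exact: c2].
exact: cs.
Qed.

(** On the left half, 2 - 2 s >= 1 makes the terms in 2 - 2 s elementary, and the
refinement equations at 2 s rewrite the others as the same expression on the
half interval; the new middle slope is the convex combination of the old ones
that the subdivision rule prescribes. *)
Lemma hermite_left lam Phi k a c b u v t : 0 < lam -> lam <= 2^-1 ->
  slope_primitive lam Phi -> u < v -> u <= t <= mid u v ->
  hermite Phi k a c b u v t =
    hermite Phi k a (lam * a + (1 - lam) * c) c u (mid u v) t /\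
  hermite' lam a c b u v t =
    hermite' lam a (lam * a + (1 - lam) * c) c u (mid u v) t.
Proof.
move=> l0 l1 [_ _ Phi1 PhiE PhiR] uv; rewrite /mid => utm.
rewrite /hermite /hermite' (_ : (u + v) / 2 - u = (v - u) / 2); last by field.
set h := v - u; have h0 : 0 < h by rewrite /h; lra.
have hn0 : h != 0 by rewrite gt_eqF.
set s := (t - u) / h.
have ts : t = u + h * s by rewrite /s; field.
have s01 : 0 <= s <= 2^-1.
  by rewrite /s ler_pdivlMr// ler_pdivrMr// mul0r /h; lra.
have -> : (t - u) / (h / 2) = 2 * s by rewrite /s; field; rewrite hn0.
rewrite (slope_refine l0 l1 (2 * s)) (slope_ge1 _ (_ : 1 <= 2 - 2 * s)); last lra.
rewrite (PhiR (2 * s)); last lra.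
rewrite (PhiE (2 - 2 * s)); last lra.
rewrite (PhiE 2); last lra.
by rewrite ts; split; field.
Qed.

(** The mirror image of [hermite_left]: the refinement equations are used at
w = 2 - 2 s, and 2 s >= 1. *)
Lemma hermite_right lam Phi k a c b u v t : 0 < lam -> lam <= 2^-1 ->
  slope_primitive lam Phi -> u < v -> mid u v <= t <= v ->
  hermite Phi k a c b u v t =
    hermite Phi (hermite Phi k a c b u v (mid u v)) c (lam * b + (1 - lam) * c) b
      (mid u v) v t /\
  hermite' lam a c b u v t =
    hermite' lam c (lam * b + (1 - lam) * c) b (mid u v) v t.
Proof.
move=> l0 l1 [_ Phi0 Phi1 PhiE PhiR] uv; rewrite /mid => utm.
rewrite /hermite /hermite' (_ : v - (u + v) / 2 = (v - u) / 2); last by field.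
rewrite (_ : (u + v) / 2 - u = (v - u) / 2); last by field.
set h := v - u; have h0 : 0 < h by rewrite /h; lra.
have hn0 : h != 0 by rewrite gt_eqF.
set w := 2 - 2 * ((t - u) / h).
have ts : t = u + h * (1 - w / 2) by rewrite /w; field.
have w01 : 0 <= w <= 1.
  suff : 2^-1 <= (t - u) / h <= 1 by rewrite /w; lra.
  by rewrite ler_pdivlMr// ler_pdivrMr// /h; lra.
have -> : 2 * (h / 2 / h) = 1 by field.
have -> : 2 * ((t - (u + v) / 2) / (h / 2)) = 2 - 2 * w.
  by rewrite /w /h; field; move: hn0; rewrite /h.
rewrite (_ : 2 - (2 - 2 * w) = 2 * w); last by ring.
have -> : 2 * ((t - u) / h) = 2 - w by rewrite /w; ring.
have -> : 2 - 1 = 1 :> R by ring.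
rewrite (slope_refine l0 l1 w) (slope_ge1 _ (_ : 1 <= 2 - w)); last lra.
rewrite (PhiR w); last lra.
rewrite (PhiE (2 - w)); last lra.
rewrite (PhiE 2); last lra.
rewrite Phi1 ts (_ : v = u + h); last by rewrite /h; ring.
by split; field; lra.
Qed.
End Hermite.

(** * The space V (beta) *)

Section SpaceV.
Context {R : realType}.
Implicit Types (p q t s u v : R) (f g : R -> R).

Lemma dyadic_subitv_le p q u v : p < q -> dyadic_subitv p q u v ->
  [/\ p <= u, u < v & v <= q].
Proof.
by move=> pq; elim=> [|{}u {}v _ [? ? ?]|{}u {}v _ [? ? ?]];
  rewrite /mid; split; lra.
Qed.

Lemma dyadic_subitv_endpoints p q u v : p < q -> dyadic_subitv p q u v ->
  [/\ u \in `[p, q], v \in `[p, q] & mid u v \in `[p, q]].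
Proof.
move=> pq /(dyadic_subitv_le pq)[pu uv vq].
by split; rewrite in_itv/= ?/mid; lra.
Qed.

Lemma theta_bounds (be : R) : -1 <= be < 0 ->
  [/\ 0 < theta be, 0 < 1 - 2 * theta be & (1 - 2 * theta be)^-1 = 1 - be].
Proof.
move=> hb; rewrite /theta.
have e1 : 1 - 2 * (2^-1 * (be / (be - 1))) = (1 - be)^-1 by field; lra.
rewrite e1 invrK invr_gt0; split=> //; last lra.
by rewrite mulr_gt0 ?invr_gt0// -mulrNN -invrN divr_gt0; lra.
Qed.

(** Self-similarity reduces the two subdivision rules on any dyadic interval to
identities between the parameters of [hermite] there, which hold because
lam = theta / (1 - 2 theta) and the integral of the slope is 1 - 2 theta. *)
Lemma hermite_V (be k a c b p q : R) Phi : -1 <= be < 0 -> p < q ->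
  slope_primitive (- be / 2) Phi ->
  V be p q (hermite Phi k a c b p q) /\
  {in `[p, q], derive_within `[p, q] (hermite Phi k a c b p q) =1
               hermite' (- be / 2) a c b p q}.
Proof.
move=> hb pq hPhi; set lam := - be / 2; set F := hermite _ _ _ _ _ _ _.
set F' := hermite' _ _ _ _ _ _.
have l0 : 0 < lam by rewrite /lam; lra.
have l1 : lam <= 2^-1 by rewrite /lam; lra.
have dF t : t \in `[p, q] -> has_deriv `[p, q] F t (F' t).
  rewrite in_itv/= => tpq; apply: has_deriv_is_derive.
  exact: is_derive_hermite.
have F'E : {in `[p, q], derive_within `[p, q] F =1 F'}.
  by move=> t tpq; apply: has_deriv_derive_within => //; exact: dF.
split=> //; split.
  apply: C1_on_intro pq dF _; apply: continuous_subspaceT.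
  exact: hermite'_continuous.
have self_similar u v : dyadic_subitv p q u v ->
    exists k1 a1 c1 b1, forall t, u <= t <= v ->
      F t = hermite Phi k1 a1 c1 b1 u v t /\ F' t = hermite' lam a1 c1 b1 u v t.
  elim=> [|{}u {}v huv [k1 [a1 [c1 [b1 E]]]]|{}u {}v huv [k1 [a1 [c1 [b1 E]]]]].
  - by exists k, a, c, b.
  - have [_ uv _] := dyadic_subitv_le pq huv.
    exists k1, a1, (lam * a1 + (1 - lam) * c1), c1 => t ut.
    have [-> ->] := E t ltac:(by move: ut; rewrite /mid; lra).
    exact: hermite_left.
  - have [_ uv _] := dyadic_subitv_le pq huv.
    exists (hermite Phi k1 a1 c1 b1 u v (mid u v)), c1,
      (lam * b1 + (1 - lam) * c1), b1 => t ut.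
    have [-> ->] := E t ltac:(by move: ut; rewrite /mid; lra).
    exact: hermite_right.
move=> u v huv; have [up vp mp] := dyadic_subitv_endpoints pq huv.
have [_ uv _] := dyadic_subitv_le pq huv.
rewrite /= !F'E//; have [k1 [a1 [c1 [b1 E]]]] := self_similar u v huv.
have [-> ->] := E u ltac:(lra).
have [-> ->] := E v ltac:(lra).
have [-> ->] := E (mid u v) ltac:(by rewrite /mid; lra).
have [_ _ ->] := theta_bounds hb.
have [_ Phi0 Phi1 PhiE _] := hPhi.
rewrite /hermite /hermite' (_ : mid u v - u = (v - u) / 2); last by rewrite /mid; field.
set h := v - u; have h0 : h != 0 by rewrite gt_eqF// /h; lra.
rewrite subrr !mul0r mulr0 divff// (_ : h / 2 / h = 2^-1); last by field.
rewrite (_ : 2 * 2^-1 = 1); last by field.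
rewrite subr0 mulr1 (subrr 2) Phi0 (_ : 2 - 1 = 1 :> R); last by ring.
rewrite (PhiE 2); last lra.
have S0 : slope lam 0 = 0 by rewrite slope_le0.
have S1 : slope lam 1 = 1 by rewrite slope_ge1.
have S2 : slope lam 2 = 1 by rewrite slope_ge1//; lra.
by rewrite S0 S1 S2 Phi1 /lam /theta; split; field; lra.
Qed.

(** The middle slope c is free in [hermite]; it is chosen as the rule for the
derivative at the midpoint dictates, and then the value at q comes out right. *)
Lemma V_hermite_exists (be p q y0 d0 y1 d1 : R) : -1 <= be < 0 -> p < q ->
  exists f, [/\ V be p q f, f p = y0, f q = y1,
    derive_within `[p, q] f p = d0 & derive_within `[p, q] f q = d1].
Proof.
move=> hb pq; set lam := - be / 2.
have l0 : 0 < lam by rewrite /lam; lra.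
have l1 : lam <= 2^-1 by rewrite /lam; lra.
have [Phi hPhi] := slope_primitive_exists l0 l1.
pose c := (1 - be) * ((y1 - y0) / (q - p) - 2 * theta be * ((d0 + d1) / 2)).
have [hV dV] := hermite_V y0 d0 c d1 hb pq hPhi.
have [_ Phi0 Phi1 PhiE _] := hPhi.
have h0 : q - p != 0 by rewrite gt_eqF//; lra.
exists (hermite Phi y0 d0 c d1 p q); split=> //.
- by rewrite /hermite subrr mul0r !mulr0 Phi0 subr0; field.
- rewrite /hermite divff// mulr1 subrr Phi0 (PhiE 2); last lra.
  by rewrite Phi1 /c /lam /theta; field; lra.
- rewrite dV ?in_itv/= ?lexx ?ltW// /hermite' subrr mul0r mulr0 subr0.
  by rewrite (slope_le0 _ (lexx 0)) (slope_ge1 _ (_ : 1 <= 2)); [ring|lra].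
- rewrite dV ?in_itv/= ?lexx ?ltW// /hermite' divff// mulr1 subrr.
  by rewrite (slope_le0 _ (lexx 0)) (slope_ge1 _ (_ : 1 <= 2)); [ring|lra].
Qed.

Lemma V_lincomb (be p q : R) (N : nat) (c : nat -> R) (F : nat -> R -> R) :
  p < q -> (forall k, (k < N)%N -> V be p q (F k)) ->
  V be p q (fun t => \sum_(0 <= k < N) c k * F k t).
Proof.
move=> pq VF; have CF k : (k < N)%N -> C1_on `[p, q] (F k) by move=> /VF[].
split; first exact: C1_on_lincomb.
move=> u v huv; have [up vp mp] := dyadic_subitv_endpoints pq huv.
rewrite /= !(derive_within_lincomb c pq CF)//.
split.
  rewrite -sumrB mulr_sumr -big_split -sumrB mulr_sumr /=.
  by apply: eq_big_nat => k /andP[_ /VF[_ /(_ u v huv)[-> _]]]; ring.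
rewrite -sumrB mulr_suml -big_split mulr_suml mulr_sumr -sumrB mulr_sumr /=.
by apply: eq_big_nat => k /andP[_ /VF[_ /(_ u v huv)[_ ->]]]; ring.
Qed.

Lemma eq_V (be p q : R) f g : p < q -> {in `[p, q], f =1 g} ->
  V be p q f -> V be p q g.
Proof.
move=> pq fg [Cf Vf]; split; first exact: eq_C1_on Cf.
move=> u v huv; have [up vp mp] := dyadic_subitv_endpoints pq huv.
by rewrite /= !(eq_derive_within pq Cf fg)// -!fg//; exact: Vf.
Qed.

Lemma dyadic_subitv_dense p q t (e : R) : p < q -> t \in `[p, q] -> 0 < e ->
  exists u v, [/\ dyadic_subitv p q u v, u <= t <= v & v - u < e].
Proof.
move=> pq; rewrite in_itv/= => tpq e0.
have small : forall k, exists u v,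
    [/\ dyadic_subitv p q u v, u <= t <= v & v - u = 2^-1 ^+ k * (q - p)].
  elim=> [|k [u [v [huv utv E]]]].
    by exists p, q; split; [exact: dyadic_self|exact: tpq|rewrite mul1r].
  have [tm|mt] := leP t (mid u v).
  - exists u, (mid u v); split; [exact: dyadic_left|by case/andP: utv => ->|].
    by rewrite exprS -mulrA -E /mid; field.
  - exists (mid u v), v; split; [exact: dyadic_right| |].
      by case/andP: utv => _ ->; rewrite ltW.
    by rewrite exprS -mulrA -E /mid; field.
have /cvgr0_norm_lt/(_ _ e0)[k _ /(_ k (leqnn k)) /= ke] :
    (fun k => 2^-1 ^+ k * (q - p)) @ \oo --> (0 : R).
  rewrite -[0](mul0r (q - p)); apply: cvgM; last exact: cvg_cst.
  by apply: cvg_expr; rewrite ger0_norm; lra.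
have [u [v [huv utv E]]] := small k; exists u, v; split=> //.
by rewrite E; apply: le_lt_trans ke; exact: ler_norm.
Qed.

(** The rules compute values and slopes at all dyadic points from those at p and
q, and dyadic points are dense. *)
Lemma V_unique (be p q : R) f g : p < q -> V be p q f -> V be p q g ->
  f p = g p -> f q = g q ->
  derive_within `[p, q] f p = derive_within `[p, q] g p ->
  derive_within `[p, q] f q = derive_within `[p, q] g q ->
  {in `[p, q], f =1 g}.
Proof.
move=> pq [Cf Vf] [Cg Vg] fgp fgq dp dq.
have dyadic_eq u v : dyadic_subitv p q u v -> [/\ f u = g u, f v = g v,
    derive_within `[p, q] f u = derive_within `[p, q] g u &
    derive_within `[p, q] f v = derive_within `[p, q] g v].
  elim=> [//|{}u {}v huv [fu fv du dv]|{}u {}v huv [fu fv du dv]];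
    have [fm dfm] := Vf u v huv; have [gm dgm] := Vg u v huv;
    by split=> //; rewrite ?fm ?gm ?dfm ?dgm fu fv du dv.
move=> t tpq; apply/eqP; rewrite -subr_eq0 -normr_le0; apply/ler_addgt0Pr => e e0.
rewrite add0r.
have cD : (fun s => f s - g s) @ within `[p, q] (nbhs t) --> f t - g t.
  by apply: cvgB; apply: has_deriv_cvg; exact: C1_on_has_deriv.
have /cvgrPdist_lt/(_ _ e0) := cD; rewrite near_withinE => -[d /= d0 hd].
have [u [v [huv utv uvd]]] := dyadic_subitv_dense pq tpq d0.
have [upq _ _] := dyadic_subitv_endpoints pq huv.
have [fu _ _ _] := dyadic_eq u v huv.
have := hd u _ upq; rewrite fu subrr subr0 => h; apply/ltW/h.
by rewrite /ball/= ger0_norm; lra.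
Qed.

Lemma V_quarter_values (be p q : R) f : -1 <= be < 0 -> p < q -> V be p q f ->
  let c1 := f p + theta be * (q - p) * derive_within `[p, q] f p in
  let c2 := f q - theta be * (q - p) * derive_within `[p, q] f q in
  4 * f (mid p (mid p q)) = f p + (2 - 2^-1 * be) * c1 + (1 + 2^-1 * be) * c2 /\
  4 * f (mid (mid p q) q) = (1 + 2^-1 * be) * c1 + (2 - 2^-1 * be) * c2 + f q.
Proof.
move=> hb pq [_ Vf]; have [_ _ thE] := theta_bounds hb.
have [fm dfm] := Vf p q (dyadic_self p q).
have [-> _] := Vf p (mid p q) (dyadic_left (dyadic_self p q)).
have [-> _] := Vf (mid p q) q (dyadic_right (dyadic_self p q)).
rewrite /= dfm fm thE /mid /theta.
by split; field; lra.
Qed.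

End SpaceV.

(** * Diagonally dominant tridiagonal systems *)

Section Tridiagonal.
Context {R : realType}.
Implicit Types (A B C r gam : nat -> R).

(** Gaussian elimination from the top: the rows up to N express gam N as an
affine function p + q * gam N.+1 with `|q| <= 1, and dominance keeps the pivot
B + A q of the next row above C, so that the bound on q persists. *)
Lemma tridiagonal_exists A B C r (N : nat) (y z : R) :
  (forall k, (1 <= k <= N)%N -> [/\ 0 <= A k, 0 <= C k & A k + C k < B k]) ->
  exists gam, [/\ gam 0%N = y, gam N.+1 = z & forall k, (1 <= k <= N)%N ->
    A k * gam k.-1 + B k * gam k + C k * gam k.+1 = r k].
Proof.
move=> h.
suff [p [q [_ /(_ z)[gam [g0 gN _ rows]]]]] : exists p q : R, `|q| <= 1 /\
    forall z, exists gam, [/\ gam 0%N = y, gam N.+1 = z, gam N = p + q * z &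
      forall k, (1 <= k <= N)%N ->
        A k * gam k.-1 + B k * gam k + C k * gam k.+1 = r k] by exists gam.
elim: N h {z} => [|N IH] h.
  exists y, 0; split=> [|z]; first by rewrite normr0.
  exists (fun k => if k == 0%N then y else z); split => //=; first by rewrite mul0r addr0.
  by case.
have [|p [q [q1 sol]]] := IH; first by move=> k /andP[k1 kN]; apply: h; rewrite k1 leqW.
have [A0 C0 ACB] := h N.+1 (leqnn _).
have Aq : `|A N.+1 * q| <= A N.+1.
  by rewrite normrM (ger0_norm A0) ler_piMr.
have D0 : C N.+1 < B N.+1 + A N.+1 * q by move: Aq; rewrite ler_norml; lra.
set D := B N.+1 + A N.+1 * q in D0.
exists ((r N.+1 - A N.+1 * p) / D), (- C N.+1 / D); split=> [|z].
  rewrite normrM normrN (ger0_norm C0) ger0_norm ?invr_ge0; last lra.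
  by rewrite ler_pdivrMr ?mul1r; lra.
set w := (r N.+1 - A N.+1 * p) / D + - C N.+1 / D * z.
have [gam [g0 gN1 gN rows]] := sol w.
exists (fun k => if (k <= N.+1)%N then gam k else z); split=> //=.
- by rewrite ltnn.
- by rewrite leqnn gN1.
move=> k /andP[k1 kN1]; have [{k1 kN1}->|kN] := eqVneq k N.+1.
  rewrite [N.+1.-1]/= ltnn leqnn leqnSn gN gN1 /w /D; field.
  by rewrite gt_eqF//; move: D0; rewrite /D; lra.
have {}kN : (k <= N)%N by rewrite -ltnS ltn_neqAle kN.
by rewrite ltnS kN kN1 (leq_trans (leq_pred k) kN1); apply: rows; rewrite k1.
Qed.

(** The difference d of two solutions starts at 0, and dominance forces `|d| to
be nondecreasing along the rows; it also ends at 0. *)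
Lemma tridiagonal_unique A B C r (N : nat) gam gam' :
  (forall k, (1 <= k <= N)%N -> [/\ 0 <= A k, 0 <= C k & A k + C k < B k]) ->
  (forall k, (1 <= k <= N)%N ->
    A k * gam k.-1 + B k * gam k + C k * gam k.+1 = r k) ->
  (forall k, (1 <= k <= N)%N ->
    A k * gam' k.-1 + B k * gam' k + C k * gam' k.+1 = r k) ->
  gam 0%N = gam' 0%N -> gam N.+1 = gam' N.+1 ->
  forall k, (k <= N.+1)%N -> gam k = gam' k.
Proof.
move=> h rows rows' g0 gN; pose d k := gam k - gam' k.
have incr k : (k <= N)%N -> `|d k| <= `|d k.+1|.
  elim: k => [|k IH] kN; first by rewrite /d g0 subrr normr0.
  have [A0 C0 ACB] := h k.+1 kN.
  have e : B k.+1 * d k.+1 = - (A k.+1 * d k) - C k.+1 * d k.+2.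
    have := rows k.+1 kN; have := rows' k.+1 kN; rewrite /d /=; lra.
  have {}IH := IH (ltnW kN).
  have : B k.+1 * `|d k.+1| <= A k.+1 * `|d k.+1| + C k.+1 * `|d k.+2|.
    rewrite -[B k.+1]ger0_norm; last lra.
    rewrite -normrM e (le_trans (ler_normB _ _))// normrN !normrM.
    by rewrite (ger0_norm A0) (ger0_norm C0) lerD2r ler_wpM2l.
  move=> le1; rewrite leNgt; apply/negP => lt1.
  have : C k.+1 * `|d k.+2| <= C k.+1 * `|d k.+1| by rewrite ler_wpM2l// ltW.
  have dpos : 0 < `|d k.+1| by exact: le_lt_trans lt1.
  have : (A k.+1 + C k.+1) * `|d k.+1| < B k.+1 * `|d k.+1| by rewrite ltr_pM2r.
  by lra.
have mono j : (j <= N.+1)%N -> `|d (N.+1 - j)%N| <= 0.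
  elim: j => [|j IH] jN; first by rewrite subn0 /d gN subrr normr0.
  apply: le_trans (IH (ltnW jN)).
  have -> : (N.+1 - j = (N.+1 - j.+1).+1)%N by lia.
  by apply: incr; lia.
move=> k kN; have := mono (N.+1 - k)%N ltac:(lia).
by rewrite subKn// normr_le0 subr_eq0 => /eqP.
Qed.

End Tridiagonal.

(** * Functions assembled over the knots *)

Section Knots.
Context {R : realType} (n : nat) (x beta : nat -> R).
Context (hn : (1 <= n)%N) (hx : forall i, (i < n)%N -> x i < x i.+1).
Context (hbeta : forall i, (1 <= i <= n)%N -> -1 <= beta i < 0).

Lemma knot_lt i : (1 <= i <= n)%N -> x i.-1 < x i.
Proof. by case: i => // i /andP[_ /hx]. Qed.

Lemma knot_le i j : (i <= j)%N -> (j <= n)%N -> x i <= x j.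
Proof.
elim: j => [|j IH]; first by rewrite leqn0 => /eqP ->.
rewrite leq_eqVlt => /orP[/eqP -> //|ij jn].
by apply: le_trans (IH ij (ltnW jn)) _; exact: ltW (hx jn).
Qed.

Lemma knot_cover t : t \in `[x 0%N, x n] ->
  exists2 i, (1 <= i <= n)%N & t \in `[x i.-1, x i].
Proof.
rewrite in_itv/= => /andP[t0].
suff H m : (0 < m)%N -> (m <= n)%N -> t <= x m ->
    exists2 i, (1 <= i <= n)%N & t \in `[x i.-1, x i] by exact: H.
elim: m => // m IH _ mn tm.
have [m0|m0] := posnP m.
  by move: mn tm; rewrite m0 => mn tm; exists 1%N => //; rewrite in_itv/= t0.
have [tm'|mt] := leP t (x m).
  exact: IH m0 (ltnW mn) tm'.
by exists m.+1; rewrite ?in_itv/= ?mn// (ltW mt).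
Qed.

Lemma piece_sub i : (1 <= i <= n)%N -> `[x i.-1, x i] `<=` `[x 0%N, x n].
Proof.
move=> /andP[i1 i_n] t /=; rewrite !in_itv/= => /andP[h1 h2].
rewrite (le_trans _ h1) ?(le_trans h2)// knot_le//.
exact: leq_trans (leq_pred _) i_n.
Qed.

Lemma paste_pieces (F : nat -> R -> R) :
  (forall i, (1 <= i < n)%N -> F i (x i) = F i.+1 (x i)) ->
  exists g : R -> R, forall i, (1 <= i <= n)%N -> {in `[x i.-1, x i], g =1 F i}.
Proof.
move=> FF.
suff H m : (m <= n)%N -> exists g : R -> R,
    forall i, (1 <= i <= m)%N -> {in `[x i.-1, x i], g =1 F i} by exact: H.
elim: m => [|m IH] mn; first by exists (fun=> 0) => -[].
have [g hg] := IH (ltnW mn).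
(* For m = 0 no piece precedes, and even the point x 0 must use F 1. *)
exists (fun t => if (0 < m)%N && (t <= x m) then g t else F m.+1 t).
move=> i /andP[i1]; rewrite leq_eqVlt => /orP[/eqP -> |im] t.
  rewrite in_itv/= => /andP[mt _]; case: ifPn => // /andP[m0 tm].
  have -> : t = x m by apply/eqP; rewrite eq_le tm mt.
  rewrite (hg m) ?m0 ?leqnn//; first by rewrite FF// m0.
  by rewrite in_itv/= lexx ltW//; apply: knot_lt; rewrite m0 ltnW.
rewrite ltnS in im; move=> ti; have := ti; rewrite in_itv/= => /andP[_ ti'].
rewrite (leq_trans i1 im) (le_trans ti' (knot_le im (ltnW mn))).
by apply: hg => //; rewrite i1.
Qed.

(** The pieces are attached one at a time from the left. *)
Lemma GS2_paste g :
  (forall i, (1 <= i <= n)%N -> V (beta i) (x i.-1) (x i) g) ->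
  (forall i, (1 <= i < n)%N -> derive_within `[x i.-1, x i] g (x i) =
                               derive_within `[x i, x i.+1] g (x i)) ->
  GS2 n x beta g.
Proof.
move=> Vg dg; split => //.
suff H m : (0 < m)%N -> (m <= n)%N -> C1_on `[x 0%N, x m] g /\
    derive_within `[x 0%N, x m] g (x m) = derive_within `[x m.-1, x m] g (x m).
  by have [] := H n hn (leqnn n).
elim: m => // m IH _ mn.
have [->|m0] := posnP m; first by split=> //; have [] := Vg 1%N ltac:(by rewrite hn).
have [Cm dm] := IH m0 (ltnW mn).
have Vm1 := Vg m.+1 mn; case: Vm1 => /= Cm1 _.
apply: C1_on_paste => //.
- apply: lt_le_trans (hx (leq_trans m0 (ltnW mn))) _.
  exact: knot_le m0 (ltnW mn).
- exact: hx.
- by rewrite dm dg// m0.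
Qed.

End Knots.

(** * Generalized quadratic B-splines *)

Section BSplines.
Context {R : realType} (n : nat) (x beta : nat -> R).
Context (hn : (1 <= n)%N) (hx : forall i, (i < n)%N -> x i < x i.+1).
Context (hbeta : forall i, (1 <= i <= n)%N -> -1 <= beta i < 0).

Local Notation w := (omega n x beta).
Local Notation tau i := (theta (beta i) * step x i).
Local Notation B := (bspline n x beta).

Lemma tau_gt0 i : (1 <= i <= n)%N -> 0 < tau i.
Proof.
move=> i1n; have [th0 _ _] := theta_bounds (hbeta i1n).
by rewrite mulr_gt0// subr_gt0; exact: knot_lt i1n.
Qed.

Lemma omegaE i : (1 <= i < n)%N -> w i = tau i.+1 / (tau i + tau i.+1).
Proof.
by move=> /andP[i1 i_n]; rewrite /omega gtn_eqF// ltn_eqF.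
Qed.

Lemma omega0 : w 0 = 1. Proof. by []. Qed.

Lemma omegan : w n = 0.
Proof. by rewrite /omega gtn_eqF// eqxx. Qed.

Lemma omega_itv i : (i <= n)%N -> 0 <= w i <= 1.
Proof.
have [->|i0] := posnP i; first by rewrite omega0 ler01 lexx.
rewrite leq_eqVlt => /orP[/eqP ->|i_n]; first by rewrite omegan lexx ler01.
have t1 := @tau_gt0 i ltac:(lia).
have t2 := @tau_gt0 i.+1 ltac:(lia).
rewrite omegaE ?i0// divr_ge0 ?ler_pdivrMr; lra.
Qed.

Lemma eq_bcoefs i f g : (1 <= i <= n)%N -> C1_on `[x i.-1, x i] f ->
  {in `[x i.-1, x i], f =1 g} -> bcoefs x beta g i = bcoefs x beta f i.
Proof.
move=> i1n Cf fg; have lti := knot_lt hx i1n.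
have le1 : x i.-1 \in `[x i.-1, x i] by rewrite in_itv/= lexx ltW.
have le2 : x i \in `[x i.-1, x i] by rewrite in_itv/= lexx ltW.
by rewrite /bcoefs /= !(eq_derive_within lti Cf fg)// !fg.
Qed.

(** Since theta and the step are positive, B-coefficients and Hermite data
determine each other. *)
Lemma V_eq_of_bcoefs i f g : (1 <= i <= n)%N ->
  V (beta i) (x i.-1) (x i) f -> V (beta i) (x i.-1) (x i) g ->
  bcoefs x beta f i = bcoefs x beta g i -> {in `[x i.-1, x i], f =1 g}.
Proof.
move=> i1n Vf Vg [e0 e1 e2 e3]; have t0 := tau_gt0 i1n.
apply: V_unique (knot_lt hx i1n) Vf Vg _ _ _ _ => //.
- by move: e1; rewrite e0 => /addrI/(mulfI (lt0r_neq0 t0)).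
- by move: e2; rewrite e3 => /addrI/oppr_inj/(mulfI (lt0r_neq0 t0)).
Qed.

Lemma V_bcoefs_exists i (c0 c1 c2 c3 : R) : (1 <= i <= n)%N ->
  exists f, V (beta i) (x i.-1) (x i) f /\
    bcoefs x beta f i = [:: c0; c1; c2; c3].
Proof.
move=> i1n; have t0 := lt0r_neq0 (tau_gt0 i1n).
have [f [Vf f0 f1 d0 d1]] := V_hermite_exists c0 ((c1 - c0) / tau i)
  c3 ((c3 - c2) / tau i) (hbeta i1n) (knot_lt hx i1n).
exists f; split=> //; rewrite /bcoefs /= f0 f1 d0 d1.
rewrite ![tau i * _]mulrC !divfK//.
by congr [:: _; _; _; _]; ring.
Qed.

(** The value at the knot x i of the B-spline of index 2i (b false) or 2i+1
(b true). *)
Definition knot_weight (b : bool) (i : nat) : R := if b then 1 - w i else w i.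

(** One formula for the lists of all B-splines: the conventions omega 0 = 1 and
omega n = 0 absorb the special cases at the two ends, and the coefficient at
each knot has the same form seen from either side. *)
Lemma bspline_bcoefsE k i : (k < (2 * n).+2)%N -> (1 <= i <= n)%N ->
  bspline_bcoefs n x beta k i =
    [:: if k./2 == i.-1 then knot_weight (odd k) i.-1 else 0;
        if k./2 == i.-1 then (odd k)%:R else 0;
        if k./2 == i then (~~ odd k)%:R else 0;
        if k./2 == i then knot_weight (odd k) i else 0].
Proof.
move=> kn i1n; have jn : (k./2 <= n)%N by lia.
rewrite /bspline_bcoefs /knot_weight; move: (k./2) (odd k) jn => j b jn.
have [->|j0] := eqVneq j 0%N.
  have [->|i1] := eqVneq i 1%N; first by rewrite omega0 subrr; case: b.
  have -> : (0 == i.-1)%N = false by lia.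
  by have -> : (0 == i)%N = false by lia.
have [->|jn'] := eqVneq j n.
  have [->|i_n] := eqVneq i n.
    rewrite omegan subr0; have -> : (n == n.-1)%N = false by lia.
    by case: b.
  by have -> : (n == i.-1)%N = false by lia.
have [->|ij] := eqVneq i j.
  have -> : (j == j.-1)%N = false by lia.
  by case: b.
have -> : (j == i.-1)%N = (i == j.+1)%N by lia.
by case: eqP => [->|//]; rewrite /=; case: b.
Qed.

(** The B-spline is defined by a choice among functions with given B-coefficients,
so such a function has to be produced: elements of V with these coefficients
exist on each piece, and they agree at the knots by [bspline_bcoefsE]. *)
Lemma bspline_piece k i : (k < (2 * n).+2)%N -> (1 <= i <= n)%N ->
  V (beta i) (x i.-1) (x i) (B k) /\
  bcoefs x beta (B k) i = bspline_bcoefs n x beta k i.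
Proof.
move=> kn; pose c := bspline_bcoefs n x beta k.
suff [g hg] : exists g, forall i, (1 <= i <= n)%N ->
    V (beta i) (x i.-1) (x i) g /\ bcoefs x beta g i = c i.
  pose S := [set h : R -> R | forall i, (1 <= i <= n)%N ->
    V (beta i) (x i.-1) (x i) h /\ bcoefs x beta h i = c i].
  by apply: (@xgetPex _ (fun=> 0) S); exists g.
have /choice[F hF] : forall i, exists f, (1 <= i <= n)%N ->
    V (beta i) (x i.-1) (x i) f /\ bcoefs x beta f i = c i.
  move=> j; have [j1n|j1n] := boolP (1 <= j <= n)%N; last by exists (fun=> 0).
  have [f hf] : exists f,
      V (beta j) (x j.-1) (x j) f /\ bcoefs x beta f j = c j.
    by rewrite /c bspline_bcoefsE//; exact: V_bcoefs_exists.
  by exists f.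
have [|g hg] := @paste_pieces _ n x hx F.
  move=> j j1n; have [_] := hF j ltac:(lia); have [_] := hF j.+1 ltac:(lia).
  rewrite /c !bspline_bcoefsE; try lia.
  by move=> [e _ _ _] [_ _ _ e']; rewrite e' -e.
exists g => j j1n; have [VF bF] := hF j j1n.
have Fg : {in `[x j.-1, x j], F j =1 g} by move=> t tj; rewrite (hg j).
split; first exact: eq_V (knot_lt hx j1n) Fg VF.
by rewrite (eq_bcoefs j1n VF.1 Fg).
Qed.

Definition spline (gam : nat -> R) (t : R) : R :=
  \sum_(0 <= k < (2 * n).+2) gam k * B k t.

Definition knot_value (gam : nat -> R) (i : nat) : R :=
  w i * gam (2 * i)%N + (1 - w i) * gam (2 * i).+1.

(** Only the indices 2j and 2j+1 contribute. *)
Lemma sum_half (m j : nat) (gam : nat -> R) (c : bool -> R) : (j < m)%N ->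
  \sum_(0 <= k < 2 * m) gam k * (if k./2 == j then c (odd k) else 0) =
  c false * gam (2 * j)%N + c true * gam (2 * j).+1.
Proof.
have H p : \sum_(0 <= k < 2 * p) gam k * (if k./2 == j then c (odd k) else 0) =
    if (j < p)%N then c false * gam (2 * j)%N + c true * gam (2 * j).+1 else 0.
  elim: p => [|p IH]; first by rewrite muln0 big_geq.
  rewrite mulnS !addSn add0n !big_nat_recr//= IH.
  have -> : (2 * p)./2 = p by lia.
  have -> : uphalf (2 * p) = p by lia.
  have -> : odd (2 * p) = false by lia.
  have -> : (j < p.+1)%N = (j == p) || (j < p)%N by rewrite ltnS leq_eqVlt.
  have [->|pj] := eqVneq j p; first by rewrite ltnn /=; ring.
  by rewrite /= !mulr0 !addr0.
by move=> jm; rewrite H jm.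
Qed.

Lemma spline_V gam i : (1 <= i <= n)%N ->
  V (beta i) (x i.-1) (x i) (spline gam).
Proof.
move=> i1n; apply: (@V_lincomb _ _ _ _ (2 * n).+2 gam B (knot_lt hx i1n)).
by move=> k kn; exact: (bspline_piece kn i1n).1.
Qed.

Lemma spline_bcoefs gam i : (1 <= i <= n)%N ->
  bcoefs x beta (spline gam) i =
  [:: knot_value gam i.-1; gam (2 * i).-1; gam (2 * i)%N; knot_value gam i].
Proof.
move=> i1n; have lti := knot_lt hx i1n.
have CB k : (k < (2 * n).+2)%N -> C1_on `[x i.-1, x i] (B k).
  by move=> kn; have [[]] := bspline_piece kn i1n.
have le1 : x i.-1 \in `[x i.-1, x i] by rewrite in_itv/= lexx ltW.
have le2 : x i \in `[x i.-1, x i] by rewrite in_itv/= lexx ltW.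
have Bk k : (k < (2 * n).+2)%N -> bcoefs x beta (B k) i = _ :=
  fun kn => etrans (bspline_piece kn i1n).2 (bspline_bcoefsE kn i1n).
rewrite /bcoefs /= !(derive_within_lincomb _ lti CB)//.
have i1n' : (i.-1 < n.+1)%N by lia.
have i1n'' : (i < n.+1)%N by lia.
have e2 : ((2 * n).+2 = 2 * n.+1)%N by lia.
have e0 : spline gam (x i.-1) = knot_value gam i.-1.
  rewrite /knot_value -(sum_half gam (knot_weight ^~ i.-1) i1n') -e2.
  by apply: eq_big_nat => k /andP[_ /Bk[-> _ _ _]].
have e3 : spline gam (x i) = knot_value gam i.
  rewrite /knot_value -(sum_half gam (knot_weight ^~ i) i1n'') -e2.
  by apply: eq_big_nat => k /andP[_ /Bk[_ _ _ ->]].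
congr [:: _; _; _; _] => //.
- rewrite /spline mulr_sumr -big_split /=.
  have -> : gam (2 * i).-1 = false%:R * gam (2 * i.-1)%N + true%:R * gam (2 * i.-1).+1.
    by rewrite mul0r add0r mul1r; congr gam; lia.
  rewrite -(sum_half gam (fun b => b%:R) i1n') -e2.
  apply: eq_big_nat => k /andP[_ /Bk[_ <- _ _]]; ring.
- rewrite /spline mulr_sumr -sumrB /=.
  have -> : gam (2 * i)%N = (~~ false)%:R * gam (2 * i)%N + (~~ true)%:R * gam (2 * i).+1.
    by rewrite mul0r addr0 mul1r.
  rewrite -(sum_half gam (fun b => (~~ b)%:R) i1n'') -e2.
  apply: eq_big_nat => k /andP[_ /Bk[_ _ <- _]]; ring.
Qed.

(** With u and v the products theta * step left and right of the knot,
omega = v / (u + v), and both one-sided derivatives equal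
(g1 - g0) / (u + v), where g0 and g1 are the coefficients of index 2i and
2i+1. *)
Lemma spline_GS2 gam : GS2 n x beta (spline gam).
Proof.
apply: GS2_paste => // [i|i i1n]; first exact: spline_V.
have i1 : (1 <= i <= n)%N by lia.
have i2 : (1 <= i.+1 <= n)%N by lia.
have t1 := tau_gt0 i1; have t2 := tau_gt0 i2.
have [_ _ e1 v1] := spline_bcoefs gam i1.
have := spline_bcoefs gam i2.
have -> : (2 * i.+1).-1 = (2 * i).+1 by lia.
rewrite /bcoefs [i.+1.-1]/= => -[v2 e2 _ _].
move: e1 e2; rewrite v1 /knot_value (omegaE i1n).
set dL := derive_within _ _ _; set dR := derive_within _ _ _.
set u := tau i in t1 *; set v := tau i.+1 in t2 *.
set g0 := gam (2 * i)%N; set g1 := gam (2 * i).+1 => eL eR.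
apply: (@mulfI _ (u * v)); first by rewrite mulf_neq0// gt_eqF.
have -> : u * v * dL = v * (u / (u + v) * (g1 - g0)).
  rewrite -mulrA mulrCA; congr (_ * _).
  have -> : u * dL = v / (u + v) * g0 + (1 - v / (u + v)) * g1 - g0.
    by rewrite -[X in _ - X]eL; ring.
  by field; lra.
have -> : u * v * dR = u * (v / (u + v) * (g1 - g0)).
  rewrite -mulrA; congr (_ * _).
  have -> : v * dR = g1 - (v / (u + v) * g0 + (1 - v / (u + v)) * g1).
    by rewrite -[X in X - _]eR; ring.
  by field; lra.
by ring.
Qed.

(** The coefficients 2j and 2j+1 are the inner B-coefficients next to the knot
x j on its left and on its right; at an end knot, where one side is missing, the
value of g takes its place. Their mean with weights omega j and 1 - omega j is
then g (x j). *)
Lemma GS2_expansion g : GS2 n x beta g ->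
  exists gam, {in `[x 0%N, x n], g =1 spline gam}.
Proof.
move=> [Cg Vg]; pose d i := derive_within `[x 0%N, x n] g (x i).
pose gam k := let j := k./2 in
  if odd k then g (x j) + (if j == n then 0 else tau j.+1 * d j)
  else g (x j) - (if j == 0%N then 0 else tau j * d j).
have gam_even j : gam (2 * j)%N = g (x j) - (if j == 0%N then 0 else tau j * d j).
  rewrite /gam; have -> : odd (2 * j) = false by lia.
  by have -> : (2 * j)./2 = j by lia.
have gam_odd j : gam (2 * j).+1 = g (x j) + (if j == n then 0 else tau j.+1 * d j).
  rewrite /gam; have -> : odd (2 * j).+1 = true by lia.
  by have -> : (2 * j).+1./2 = j by lia.
have kv j : (j <= n)%N -> knot_value gam j = g (x j).
  move=> jn; rewrite /knot_value gam_even gam_odd.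
  have [->|j0] := posnP j; first by rewrite omega0; ring.
  have [->|jn'] := eqVneq j n; first by rewrite omegan; ring.
  have jj : (1 <= j < n)%N by rewrite j0 ltn_neqAle jn'.
  have t1 := @tau_gt0 j ltac:(lia); have t2 := @tau_gt0 j.+1 ltac:(lia).
  by rewrite omegaE//; field; lra.
exists gam => t /(knot_cover hn)[i i1n ti].
have lti := knot_lt hx i1n.
have le1 : x i.-1 \in `[x i.-1, x i] by rewrite in_itv/= lexx ltW.
have le2 : x i \in `[x i.-1, x i] by rewrite in_itv/= lexx ltW.
apply: (V_eq_of_bcoefs i1n (Vg i i1n) (spline_V gam i1n)) => //.
rewrite spline_bcoefs// !kv; try lia.
rewrite /bcoefs /= !(derive_withinS lti (piece_sub hx i1n) Cg)//.
have -> : (2 * i).-1 = (2 * i.-1).+1 by lia.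
rewrite gam_even gam_odd prednK; last by lia.
have -> : (i == 0)%N = false by lia.
by have -> : (i.-1 == n)%N = false by lia.
Qed.

Definition collocation_system (f : R -> R) (gam : nat -> R) : Prop :=
  [/\ gam 0%N = f (x 0%N), gam (2 * n).+1 = f (x n) &
   forall i, (1 <= i <= n)%N ->
     w i.-1 * gam (2 * i - 2)%N + (3 - w i.-1 - 2^-1 * beta i) * gam (2 * i - 1)%N
       + (1 + 2^-1 * beta i) * gam (2 * i)%N = 4 * f (mpt' x i) /\
     (1 + 2^-1 * beta i) * gam (2 * i - 1)%N
       + (2 + w i - 2^-1 * beta i) * gam (2 * i)%N
       + (1 - w i) * gam (2 * i).+1 = 4 * f (mpt'' x i)].

Lemma spline_interpolates f gam :
  interpolates n x f (spline gam) <-> collocation_system f gam.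
Proof.
have [v0 _ _ _] := spline_bcoefs gam (i := 1) ltac:(by rewrite hn).
have [_ _ _ vn] := spline_bcoefs gam (i := n) ltac:(by rewrite hn leqnn).
have e0 : spline gam (x 0%N) = gam 0%N.
  by rewrite v0 /knot_value omega0 /=; ring.
have en : spline gam (x n) = gam (2 * n).+1.
  by rewrite vn /knot_value omegan; ring.
have ei i : (1 <= i <= n)%N ->
    4 * spline gam (mpt' x i) =
      w i.-1 * gam (2 * i - 2)%N + (3 - w i.-1 - 2^-1 * beta i) * gam (2 * i - 1)%N
       + (1 + 2^-1 * beta i) * gam (2 * i)%N /\
    4 * spline gam (mpt'' x i) = (1 + 2^-1 * beta i) * gam (2 * i - 1)%N
       + (2 + w i - 2^-1 * beta i) * gam (2 * i)%N
       + (1 - w i) * gam (2 * i).+1.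
  move=> i1n; have [q1 q2] := V_quarter_values (hbeta i1n) (knot_lt hx i1n)
    (spline_V gam i1n).
  have [c0 c1 c2 c3] := spline_bcoefs gam i1n.
  rewrite /mpt' /mpt'' /mpt q1 q2 c1 c2 c0 c3 /knot_value.
  have -> : (2 * i - 2 = 2 * i.-1)%N by lia.
  have -> : (2 * i - 1 = (2 * i).-1)%N by lia.
  have -> : (2 * i.-1).+1 = (2 * i).-1 by lia.
  by split; ring.
have four : (4 : R) != 0 by [].
split=> [[f0 fn fi]|[f0 fn fi]]; split; rewrite -?e0 -?en ?e0 ?en//.
- by rewrite -e0.
- by rewrite -en.
- by move=> i i1n; have [<- <-] := ei i i1n; have [-> ->] := fi i i1n.
- move=> i i1n; have [h1 h2] := fi i i1n; have [k1 k2] := ei i i1n.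
  by split; apply: (mulfI four); rewrite ?k1 ?k2.
Qed.

(** Renumbering of the two equations of each piece as rows k = 2i-1 and k = 2i of
one tridiagonal system, so that i = uphalf k. *)
Lemma collocation_rowsP f gam : collocation_system f gam <->
  [/\ gam 0%N = f (x 0%N), gam (2 * n).+1 = f (x n) &
    forall k, (1 <= k <= 2 * n)%N -> let i := uphalf k in
      (if odd k then w i.-1 else 1 + 2^-1 * beta i) * gam k.-1
      + (if odd k then 3 - w i.-1 - 2^-1 * beta i
         else 2 + w i - 2^-1 * beta i) * gam k
      + (if odd k then 1 + 2^-1 * beta i else 1 - w i) * gam k.+1
      = 4 * f (if odd k then mpt' x i else mpt'' x i)].
Proof.
split=> -[g0 gn rows]; split=> //; [move=> k k2n i|move=> i i1n].
  have i1n : (1 <= i <= n)%N by rewrite /i; lia.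
  have [r1 r2] := rows i i1n; case: ifPn => ko.
    have -> : (k.-1 = 2 * i - 2)%N by rewrite /i; lia.
    have -> : (k.+1 = 2 * i)%N by rewrite /i; lia.
    by have -> : (k = 2 * i - 1)%N by rewrite /i; lia.
  have -> : (k.-1 = 2 * i - 1)%N by rewrite /i; lia.
  by have -> : (k = 2 * i)%N by rewrite /i; lia.
have := rows (2 * i - 1)%N ltac:(lia); have := rows (2 * i)%N ltac:(lia).
have -> : uphalf (2 * i) = i by lia.
have -> : uphalf (2 * i - 1) = i by lia.
have -> : odd (2 * i) = false by lia.
have -> : odd (2 * i - 1) = true by lia.
have -> : ((2 * i - 1).-1 = 2 * i - 2)%N by lia.
have -> : ((2 * i - 1).+1 = 2 * i)%N by lia.
by have -> : ((2 * i).-1 = 2 * i - 1)%N by lia.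
Qed.

Lemma collocation_dominant k : (1 <= k <= 2 * n)%N -> let i := uphalf k in
  [/\ 0 <= (if odd k then w i.-1 else 1 + 2^-1 * beta i),
      0 <= (if odd k then 1 + 2^-1 * beta i else 1 - w i) &
      (if odd k then w i.-1 else 1 + 2^-1 * beta i)
      + (if odd k then 1 + 2^-1 * beta i else 1 - w i)
      < (if odd k then 3 - w i.-1 - 2^-1 * beta i
         else 2 + w i - 2^-1 * beta i)].
Proof.
move=> k2n i; have hb := @hbeta i ltac:(rewrite /i; lia).
have w1 := @omega_itv i.-1 ltac:(rewrite /i; lia).
have w2 := @omega_itv i ltac:(rewrite /i; lia).
by case: ifP => _; split; lra.
Qed.

Lemma collocation_exists f : exists gam, collocation_system f gam.
Proof.
have [gam hgam] := tridiagonal_exists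
  (fun k => 4 * f (if odd k then mpt' x (uphalf k) else mpt'' x (uphalf k)))
  (f (x 0%N)) (f (x n)) collocation_dominant.
by exists gam; apply/collocation_rowsP.
Qed.

Lemma collocation_unique f gam gam' :
  collocation_system f gam -> collocation_system f gam' ->
  forall k, (k <= (2 * n).+1)%N -> gam k = gam' k.
Proof.
move=> /collocation_rowsP[g0 gn rows] /collocation_rowsP[g0' gn' rows'].
by apply: tridiagonal_unique collocation_dominant rows rows' _ _;
  rewrite ?g0 ?g0' ?gn ?gn'.
Qed.

Lemma eq_interpolates f g g' : {in `[x 0%N, x n], g =1 g'} ->
  interpolates n x f g -> interpolates n x f g'.
Proof.
move=> gg' [f0 fn fi].
have x0n : x 0%N <= x n by apply: (knot_le hx).
have x0 : x 0%N \in `[x 0%N, x n] by rewrite in_itv/= lexx.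
have xn : x n \in `[x 0%N, x n] by rewrite in_itv/= lexx andbT.
split; [by rewrite -gg'|by rewrite -gg'|move=> i i1n].
have lti := knot_lt hx i1n.
have mid_in t : x i.-1 <= t <= x i -> t \in `[x 0%N, x n].
  by move=> ti; apply: (piece_sub hx i1n); rewrite /= in_itv.
have [<- <-] := fi i i1n.
by split; rewrite gg'// mid_in// /mpt' /mpt'' /mpt /mid; lra.
Qed.
End BSplines.

Theorem theorem10 (R : realType) (n : nat) (a b : R) (x beta : nat -> R)
    (hn : (1 <= n)%N)
    (hxa : x 0%N = a) (hxb : x n = b)
    (hx : forall i : nat, (i < n)%N -> x i < x i.+1)
    (hbeta : forall i : nat, (1 <= i <= n)%N -> -1 <= beta i < 0)
    (f : R -> R) :
  (exists Lf : R -> R,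
     [/\ GS2 n x beta Lf, interpolates n x f Lf &
         forall g : R -> R, GS2 n x beta g -> interpolates n x f g ->
           forall t : R, t \in `[a, b] -> g t = Lf t]) /\
  (forall Lf : R -> R, GS2 n x beta Lf -> interpolates n x f Lf ->
     (exists gamma : nat -> R, bspline_expansion n x beta Lf gamma) /\
     forall gamma : nat -> R, bspline_expansion n x beta Lf gamma ->
       [/\ gamma 0%N = f a,
           gamma (2 * n).+1 = f b &
           forall i : nat, (1 <= i <= n)%N ->
             omega n x beta i.-1 * gamma (2 * i - 2)%N
               + (3 - omega n x beta i.-1 - 2^-1 * beta i)
                   * gamma (2 * i - 1)%N
               + (1 + 2^-1 * beta i) * gamma (2 * i)%N
             = 4 * f (mpt' x i) /\
             (1 + 2^-1 * beta i) * gamma (2 * i - 1)%N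
               + (2 + omega n x beta i - 2^-1 * beta i) * gamma (2 * i)%N
               + (1 - omega n x beta i) * gamma (2 * i).+1
             = 4 * f (mpt'' x i)]).
Proof.
subst a b.
have [gam hgam] := collocation_exists hn hx hbeta f.
split.
  exists (spline n x beta gam); split.
  - exact: spline_GS2.
  - exact/(spline_interpolates hn hx hbeta).
  move=> g Gg Ig t tab; have [gam' gE] := GS2_expansion hn hx hbeta Gg.
  have hgam' : collocation_system n x beta f gam'.
    by apply/(spline_interpolates hn hx hbeta); exact: eq_interpolates gE Ig.
  rewrite gE//; apply: eq_big_nat => k /andP[_ k2n].
  by rewrite (collocation_unique hn hx hbeta hgam hgam').
move=> g Gg Ig; split.
  have [gam' gE] := GS2_expansion hn hx hbeta Gg.
  by exists gam' => t /gE.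
move=> gam' gE.
by apply/(spline_interpolates hn hx hbeta); exact: eq_interpolates gE Ig.
Qed.
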